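(* For each $p = 2^n \geq 4$, each $k$ from $1$ to $p$, and all $i,j\in\{1,\dots,p\}$ distinct from $k$, $$M_p[i,j] = M_p^*[\sigma_{p,k}(i), \sigma_{p,k}(j)].$$ In particular, the edge-weighted digraphs with adjacency matrices $M_p$ and $M_p^*$ are hypomorphic under the mappings $\sigma_{p,k}$.
   Context: Throughout, $p = 2^n$ with $n \ge 2$. The $4\times 4$ matrices $M_4$ and $M_4^*$ are, row by row, $M_4$: $(0,1,2,3)$, $(-1,0,3,-2)$, $(-2,-3,0,1)$, $(-3,2,-1,0)$; $M_4^*$: $(0,-2,-3,-1)$, $(2,0,1,-3)$, $(3,-1,0,2)$, $(1,3,-2,0)$. For $p = 2^n \ge 8$, $M_p$ and $M_p^*$ are $p\times p$ matrices consisting of a $(p/4)\times(p/4)$ array of $4\times 4$ blocks; with $I$ the $4\times 4$ identity and $1\le a,b\le p/4$ block indices, block $(a,b)$ of $M_p$ is: $M_4$ if $b-a=0$; $-M_4+4I$ if $b-a\equiv 1 \pmod 4$; $-M_4-4I$ if $b-a\equiv -1\pmod 4$; $M_4+(x+4)I$ if $b-a = y\cdot 2^x$ with $x\ge 1$ and $y\equiv 1\pmod 4$; $M_4-(x+4)I$ if $b-a=y\cdot 2^x$ with $x\ge1$ and $y\equiv -1\pmod 4$. Block $(a,b)$ of $M_p^*$ is: $M_4^*$ if $b-a=0$; $-M_4^*-4I$ if $b-a\equiv 1\pmod 4$; $-M_4^*+4I$ if $b-a\equiv -1\pmod 4$; $M_4^*-(x+4)I$ if $b-a=y\cdot 2^x$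 with $x\ge1$, $y\equiv 1\pmod 4$; $M_4^*+(x+4)I$ if $b-a=y\cdot 2^x$ with $x\ge 1$, $y\equiv -1\pmod 4$. For each $k\in\{1,\dots,p\}$, $\sigma_{p,k}$ is a map from $\{1,\dots,p\}\setminus\{k\}$ to itself, defined inductively. For $p=4$: $\sigma_{4,1}: 2\mapsto 4, 3\mapsto 2, 4\mapsto 3$; $\sigma_{4,2}: 1\mapsto 3, 3\mapsto 4, 4\mapsto 1$; $\sigma_{4,3}: 1\mapsto 4, 2\mapsto 1, 4\mapsto 2$; $\sigma_{4,4}: 1\mapsto 2, 2\mapsto 3, 3\mapsto 1$. For $p\ge 8$ and $i\ne k$: if $k\le p/2$, then $\sigma_{p,k}(i)=\sigma_{p/2,k}(i)+p/2$ for $i\le p/2$; $\sigma_{p,k}(i)=\sigma_{p/2,k}(i-p/2)$ for $i>p/2$, $i\ne k+p/2$; and $\sigma_{p,k}(k+p/2)=k+p/2$. If $k>p/2$, then $\sigma_{p,k}(i)=\sigma_{p/2,k-p/2}(i)+p/2$ for $i\le p/2$, $i\ne k-p/2$; $\sigma_{p,k}(i)=\sigma_{p/2,k-p/2}(i-p/2)$ for $i>p/2$; and $\sigma_{p,k}(k-p/2)=k-p/2$. Edge-weighted digraphs with adjacency matrices $A$, $B$ on points $1,\dots,p$ are hypomorphic if for each $k$ there is a bijection of the remaining points carrying the weights of $A$ with point $k$ deleted to those of $B$ with some point deleted, the deleted points of $B$ ranging over all points. *)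

(* Defs.v *)
From HB Require Import structures.
From mathcomp Require Import all_boot all_order all_algebra.
Set Implicit Arguments.
Unset Strict Implicit.
Unset Printing Implicit Defensive.
Import Order.TTheory GRing.Theory Num.Theory.
Local Open Scope ring_scope.

(* The points 1, ..., p are represented by the ordinals 0, ..., p - 1 of 'I_p:
   ordinal i stands for the point i + 1.  Differences of indices are unaffected
   by the shift; the case tables below are shifted accordingly.               *)

Definition M4 : 'M[int]_4 := \matrix_(i, j)
  nth 0 (nth [::] [:: [:: 0; 1; 2; 3];
                      [:: -1; 0; 3; -2];
                      [:: -2; -3; 0; 1];
                      [:: -3; 2; -1; 0]] i) j.

Definition M4star : 'M[int]_4 := \matrix_(i, j)
  nth 0 (nth [::] [:: [:: 0; -2; -3; -1];
                      [:: 2; 0; 1; -3];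
                      [:: 3; -1; 0; 2];
                      [:: 1; 3; -2; 0]] i) j.

(* d = odd_part d * 2 ^ val2 d with odd_part d odd, for d != 0. *)
Definition val2 (d : int) : nat := logn 2 `|d|%N.
Definition odd_part (d : int) : int := (d %/ 2 ^+ val2 d)%Z.

(* In the last two cases d is even, so val2 d >= 1; in the very last one
   odd_part d, being odd, is congruent to -1 mod 4.                           *)
Definition block (d : int) : 'M[int]_4 :=
  if d == 0 then M4
  else if (d == 1 %[mod 4])%Z then - M4 + 4%:M
  else if (d == -1 %[mod 4])%Z then - M4 - 4%:M
  else if (odd_part d == 1 %[mod 4])%Z then M4 + ((val2 d)%:Z + 4)%:M
  else M4 - ((val2 d)%:Z + 4)%:M.

Definition block_star (d : int) : 'M[int]_4 :=
  if d == 0 then M4star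
  else if (d == 1 %[mod 4])%Z then - M4star - 4%:M
  else if (d == -1 %[mod 4])%Z then - M4star + 4%:M
  else if (odd_part d == 1 %[mod 4])%Z then M4star - ((val2 d)%:Z + 4)%:M
  else M4star + ((val2 d)%:Z + 4)%:M.

(* Entry (i, j) lies in block (i %/ 4, j %/ 4), at position (i %% 4, j %% 4).
   For n = 2 there is a single block, with b - a = 0, so M 2 is M4.  Only
   n >= 2 is meaningful.                                                      *)
Definition M (n : nat) : 'M[int]_(2 ^ n) := \matrix_(i, j)
  block ((j %/ 4)%N%:Z - (i %/ 4)%N%:Z) (inord (i %% 4)) (inord (j %% 4)).

Definition Mstar (n : nat) : 'M[int]_(2 ^ n) := \matrix_(i, j)
  block_star ((j %/ 4)%N%:Z - (i %/ 4)%N%:Z) (inord (i %% 4)) (inord (j %% 4)).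

Local Open Scope nat_scope.

(* Row k lists the images of 0, 1, 2, 3; the k-th entry of row k (here k) is
   a placeholder, as the map is not defined at k.                             *)
Definition sigma4_table : seq (seq nat) :=
  [:: [:: 0; 3; 1; 2];
      [:: 2; 1; 3; 0];
      [:: 3; 0; 2; 1];
      [:: 1; 2; 0; 3]].

(* sigma_nat n k i is sigma_{2^n, k}(i), meaningful for n >= 2, k, i < 2 ^ n
   and i != k; the values for n < 2 are irrelevant.                           *)
Fixpoint sigma_nat (n k i : nat) {struct n} : nat :=
  match n with
  | 0 | 1 => i
  | 2 => nth 0 (nth [::] sigma4_table k) i
  | m.+1 =>
      let h := 2 ^ m in
      if k < h then
        if i < h then sigma_nat m k i + h
        else if i == k + h then i
        else sigma_nat m k (i - h)
      else
        if i < h then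
          if i == k - h then i else sigma_nat m (k - h) i + h
        else sigma_nat m (k - h) (i - h)
  end.

Lemma sigma_nat_range n k i : k < 2 ^ n -> i < 2 ^ n -> i != k ->
  (sigma_nat n k i < 2 ^ n) && (sigma_nat n k i != k).
Proof.
elim: n k i => [|[|[|n]] IHn] k i; try by move=> kn iN ->; rewrite iN.
  by case: k => [|[|[|[|k]]]] //; case: i => [|[|[|[|i]]]].
have -> : sigma_nat n.+3 k i = let h := 2 ^ n.+2 in
      if k < h then
        if i < h then sigma_nat n.+2 k i + h
        else if i == k + h then i
        else sigma_nat n.+2 k (i - h)
      else
        if i < h then
          if i == k - h then i else sigma_nat n.+2 (k - h) i + h
        else sigma_nat n.+2 (k - h) (i - h) by [].
rewrite /= expnS mul2n -addnn; set h := 2 ^ n.+2 in IHn *.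
move=> kh ih ik; have [k_lt|k_ge] := ltnP k h; have [i_lt|i_ge] := ltnP i h.
- have /andP[s_lt s_k] := IHn k i k_lt i_lt ik.
  rewrite ltn_add2r s_lt neq_ltn; apply/orP; right.
  by rewrite (leq_trans k_lt) ?leq_addl.
- have [->|ikh] := eqVneq i (k + h).
    by rewrite ltn_add2r k_lt -{2}[k]addn0 eqn_add2l -lt0n expn_gt0.
  have ih_lt : i - h < h by rewrite ltn_subLR.
  have ihk : i - h != k by rewrite -(eqn_add2r h) subnK.
  have /andP[s_lt s_k] := IHn k _ k_lt ih_lt ihk.
  by rewrite s_k (leq_trans s_lt) ?leq_addl.
- have kh_lt : k - h < h by rewrite ltn_subLR.
  have [_|ikh] := eqVneq i (k - h).
    by rewrite ih ik.
  have /andP[s_lt s_k] := IHn _ i kh_lt i_lt ikh.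
  by move: s_k; rewrite -(eqn_add2r h) subnK // => ->; rewrite ltn_add2r s_lt.
have kh_lt : k - h < h by rewrite ltn_subLR.
have ih_lt : i - h < h by rewrite ltn_subLR.
have ihk : i - h != k - h by rewrite -(eqn_add2r h) !subnK.
have /andP[s_lt s_k] := IHn _ _ kh_lt ih_lt ihk.
rewrite (leq_trans s_lt) ?leq_addl //= neq_ltn.
by rewrite (leq_trans s_lt).
Qed.

Definition points_but (p : nat) (k : 'I_p) := {i : 'I_p | i != k}.

Lemma sigma_lt n (k : 'I_(2 ^ n)) (i : points_but k) :
  sigma_nat n k (val i) < 2 ^ n.
Proof.
by case/andP: (sigma_nat_range (ltn_ord k) (ltn_ord (val i)) (valP i)).
Qed.

Lemma sigma_neq n (k : 'I_(2 ^ n)) (i : points_but k) :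
  Ordinal (sigma_lt i) != k.
Proof.
by case/andP: (sigma_nat_range (ltn_ord k) (ltn_ord (val i)) (valP i)).
Qed.

Definition sigma (n : nat) (k : 'I_(2 ^ n)) (i : points_but k) : points_but k :=
  exist _ (Ordinal (sigma_lt i)) (sigma_neq i).

Arguments sigma {n} k i.

(* The edge-weighted digraphs with adjacency matrices A and B are hypomorphic
   under the maps f k, where f k carries A with point k deleted to B with
   point del k deleted, and del k ranges over all points.                     *)
Definition hypomorphic_under (R : Type) (p : nat) (A B : 'M[R]_p)
    (del : 'I_p -> 'I_p)
    (f : forall k : 'I_p, points_but k -> points_but (del k)) : Prop :=
  bijective del /\
  forall k : 'I_p, bijective (f k) /\
    forall i j : points_but k, A (sval i) (sval j) = B (sval (f k i)) (sval (f k j)).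

(* Main.v *)
(* Every entry of M_p and of its starred companion is a term in the position
   inside the 4x4 block, whose sign depends on the parity of the block
   difference d, plus (minus, for the companion), at diagonal positions, an
   odd function of d depending on the 2-adic valuation of d and on the odd
   part of d modulo 4. Hence, for i and j distinct modulo h = 2 ^ m,
   translating one of them by h acts on the entry by an involution phi_m
   depending only on m and on the entry, hence common to both matrices. At a
   recursive step, sigma_(2h,k) applies sigma_(h,k) modulo h and switches
   halves, and fixes the other point congruent to k. So pairs avoiding k
   modulo h transform as at level h, and pairs involving that fixed point
   reduce to M[i,k] = phi_m (M-star[sigma i,k]) and its transpose, which
   follow by the same induction, since phi_(m+1) fixes entries off the
   diagonal classes modulo h. *)

Require Import Defs.
From mathcomp Require Import all_boot all_order all_algebra.
From mathcomp Require Import zify ring.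

Set Implicit Arguments.
Unset Strict Implicit.
Unset Printing Implicit Defensive.
Import Order.TTheory GRing.Theory Num.Theory.
Local Open Scope ring_scope.

(** * Signs and 2-adic weights of block differences *)

Definition sign4 (o : int) : int := if (o == 1 %[mod 4])%Z then 1 else -1.

Definition diag_weight (d : int) : int :=
  if d == 0 then 0 else sign4 (odd_part d) * ((val2 d)%:Z + 4).

Definition parity_sign (d : int) : int := if (2 %| d)%Z then 1 else -1.

Lemma Posz_pow2 x : Posz (2 ^ x) = 2 ^+ x.
Proof. by rewrite -natz natrX. Qed.

Lemma val2_mul v (o : int) : ~~ (2 %| o)%Z -> val2 (2 ^+ v * o) = v.
Proof.
move=> o_odd; rewrite /val2 abszM abszX lognM ?expn_gt0 //; last first.
  by rewrite absz_gt0; apply: contraNneq o_odd => ->.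
by rewrite pfactorK // logn_coprime ?addn0 // prime_coprime.
Qed.

Lemma odd_part_mul v (o : int) : ~~ (2 %| o)%Z -> odd_part (2 ^+ v * o) = o.
Proof. by move=> o_odd; rewrite /odd_part val2_mul // mulKz // expf_neq0. Qed.

Lemma odd_decomp (d : int) : d != 0 ->
  exists v, exists2 o, ~~ (2 %| o)%Z & d = 2 ^+ v * o.
Proof.
move=> d0; have := @pfactor_coprime 2 `|d| isT; rewrite absz_gt0 => /(_ d0)[m m_odd dE].
exists (logn 2 `|d|), (sgz d * m%:Z).
  by rewrite dvdzE abszM /= -prime_coprime //; case: sgzP d0 => //; rewrite mul1n.
by rewrite [LHS]intEsg [in LHS]dE PoszM Posz_pow2 mulrA mulrC.
Qed.

Lemma diag_weight_mul v (o : int) : ~~ (2 %| o)%Z ->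
  diag_weight (2 ^+ v * o) = sign4 o * (v%:Z + 4).
Proof.
move=> o_odd; rewrite /diag_weight val2_mul // odd_part_mul // ifN //.
by rewrite mulf_neq0 ?expf_neq0 //; apply: contraNneq o_odd => ->.
Qed.

Lemma diag_weight_pow x : diag_weight (2 ^+ x) = x%:Z + 4.
Proof. by rewrite -[2 ^+ x]mulr1 diag_weight_mul // mul1r. Qed.

Lemma diag_weight_opp_pow x : diag_weight (- 2 ^+ x) = - (x%:Z + 4).
Proof. by rewrite -[2 ^+ x]mulr1 -mulrN diag_weight_mul // mulN1r. Qed.

(** Adding 2 swaps the odd classes modulo 4, while higher powers of two vanish modulo 4. *)
Lemma sign4_add o w : ~~ (2 %| o)%Z ->
  sign4 (o + 2 ^+ w.+1) = if w == 0 then - sign4 o else sign4 o.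
Proof.
rewrite /sign4; case: w => [|w] /= o_odd.
  have -> : (o + 2 ^+ 1 == 1 %[mod 4])%Z = ~~ (o == 1 %[mod 4])%Z.
    by rewrite expr1; lia.
  by case: (o == 1 %[mod 4])%Z; rewrite ?opprK.
have -> : (2 : int) ^+ w.+2 = 4 * 2 ^+ w by rewrite !exprS; ring.
by rewrite mulrC addrC modzMDl.
Qed.

Lemma normr_sign4 o : `|sign4 o| = 1.
Proof. by rewrite /sign4; case: ifP. Qed.

(* |weight of d| records the valuation v of d; adding 2 ^ x to d, where v < x,
   changes the odd part modulo 4 exactly when v = x - 1. *)
Lemma diag_weight_add x d : ~~ (2 ^+ x %| d)%Z ->
  diag_weight (d + 2 ^+ x) =
  if `|diag_weight d| == x%:Z + 3 then - diag_weight d else diag_weight d.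
Proof.
have [-> | d0] := eqVneq d 0; first by rewrite dvdz0.
have [v [o o_odd ->]] := odd_decomp d0 => ndvd.
have [w xE] : exists w, x = (v + w.+1)%N.
  exists (x - v).-1; have [lexv|] := leqP x v; last by lia.
  by case/negP: ndvd; apply: dvdz_mulr; rewrite -(subnK lexv) exprD dvdz_mull.
have -> : 2 ^+ v * o + 2 ^+ x = 2 ^+ v * (o + 2 ^+ w.+1).
  by rewrite xE exprD mulrDr.
have o'_odd : ~~ (2 %| o + 2 ^+ w.+1)%Z.
  by rewrite rpredDr // exprS dvdz_mulr.
rewrite !diag_weight_mul // normrM normr_sign4 mul1r sign4_add //.
have -> : (`|v%:Z + 4| == x%:Z + 3) = (w == 0) by lia.
by case: ifP; rewrite ?mulNr.
Qed.

(** * Common closed form of the block entries *)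

Definition shape_entry (B : 'M[int]_4) (t d : int) (r s : 'I_4) : int :=
  parity_sign d * B r s + (t * diag_weight d) *+ (r == s).

Lemma diag_weight_odd d : ~~ (2 %| d)%Z -> diag_weight d = sign4 d * 4.
Proof. by move=> d_odd; rewrite -[d]mul1r -(expr0 2) diag_weight_mul // mul1r. Qed.

(** For odd [d] the valuation is 0 and the odd part is [d] itself, so the terms [4%:M] are the
    general diagonal term at valuation 0. *)
Lemma blockE d r s : block d r s = shape_entry M4 1 d r s.
Proof.
rewrite /block /shape_entry mul1r.
have [->|d0] := eqVneq d 0; first by rewrite mul1r /diag_weight eqxx mul0rn addr0.
case: ifP => [d1|d1].
  have d_odd : ~~ (2 %| d)%Z by lia.
  by rewrite diag_weight_odd // /parity_sign /sign4 ifN // d1 !mxE mulN1r mul1r.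
case: ifP => [d3|d3].
  have d_odd : ~~ (2 %| d)%Z by lia.
  by rewrite diag_weight_odd // /parity_sign /sign4 ifN // d1 !mxE !mulN1r mulNrn.
have d_even : (2 %| d)%Z by lia.
rewrite /parity_sign d_even mul1r /diag_weight (negPf d0) /sign4.
by case: ifP => _; rewrite !mxE ?mul1r // mulN1r mulNrn.
Qed.

Lemma block_starE d r s : block_star d r s = shape_entry M4star (-1) d r s.
Proof.
rewrite /block_star /shape_entry mulN1r.
have [->|d0] := eqVneq d 0; first by rewrite mul1r /diag_weight eqxx oppr0 mul0rn addr0.
case: ifP => [d1|d1].
  have d_odd : ~~ (2 %| d)%Z by lia.
  by rewrite diag_weight_odd // /parity_sign /sign4 ifN // d1 !mxE mulN1r mul1r mulNrn.
case: ifP => [d3|d3].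
  have d_odd : ~~ (2 %| d)%Z by lia.
  by rewrite diag_weight_odd // /parity_sign /sign4 ifN // d1 !mxE !mulN1r opprK.
have d_even : (2 %| d)%Z by lia.
rewrite /parity_sign d_even mul1r /diag_weight (negPf d0) /sign4.
by case: ifP => _; rewrite !mxE ?mul1r ?mulN1r ?opprK // mulNrn.
Qed.

(** * Effect on entries of translating an index by a power of two *)

Definition weight (B : 'M[int]_4) (t : int) (i j : nat) : int :=
  shape_entry B t ((j %/ 4)%N%:Z - (i %/ 4)%N%:Z)
    (inord (i %% 4)) (inord (j %% 4)).

(* The involution phi_m, whose sign change has two causes: for m = 2, the parity
   of the block difference changes (entries of the 4x4 matrices are less than 4);
   for m > 2, a diagonal position has valuation m - 3, hence weight
   (m - 3) + 4 in norm. *)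
Definition flip (m : nat) (z : int) : int :=
  if (if m == 2 then `|z| < 4 else `|z| == m%:Z + 1) then - z else z.

Lemma flipK m : involutive (flip m).
Proof.
move=> z; rewrite /flip (fun_if Num.norm) normrN if_same.
by case: (if m == 2 then _ else _); rewrite ?opprK.
Qed.

Lemma normr_parity_sign d : `|parity_sign d| = 1.
Proof. by rewrite /parity_sign; case: ifP. Qed.

Lemma parity_sign_add1 d : parity_sign (d + 1) = - parity_sign d.
Proof.
have dE : (2 %| d + 1)%Z = ~~ (2 %| d)%Z by lia.
by rewrite /parity_sign dE; case: (2 %| d)%Z; rewrite ?opprK.
Qed.

Section Weight.

Variables (B : 'M[int]_4) (t : int).
Hypotheses (B_diag : forall r, B r r = 0) (B_lt : forall r s, `|B r s| < 4).
Hypothesis normr_t : `|t| = 1.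

Lemma inord_mod4 i j :
  (inord (i %% 4) == inord (j %% 4) :> 'I_4) = (i == j %[mod 4]).
Proof. by rewrite -val_eqE /= !inordK ?ltn_mod. Qed.

Lemma weight_diag_class i j : i = j %[mod 4] ->
  weight B t i j = t * diag_weight ((j %/ 4)%N%:Z - (i %/ 4)%N%:Z).
Proof.
by move=> ijE; rewrite /weight /shape_entry ijE eqxx B_diag mulr0 add0r.
Qed.

Lemma pow2_ge4E m : (2 <= m)%N -> (2 ^ m = 2 ^ (m - 2) * 4)%N.
Proof. by move=> m2; rewrite -{1}(subnK m2) expnD. Qed.

Lemma weight_shift m i j : (2 <= m)%N ->
  weight B t (i + 2 ^ m) (j + 2 ^ m) = weight B t i j.
Proof.
move=> m2; rewrite /weight pow2_ge4E // !(addnC _ (_ * 4)%N) !divnMDl // !modnMDl.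
by congr shape_entry; lia.
Qed.

Lemma weight_addr m i j : (2 <= m)%N -> i != j %[mod 2 ^ m] ->
  weight B t i (j + 2 ^ m) = flip m (weight B t i j).
Proof.
move=> m2 ij; have [ij4|ij4] := eqVneq (i %% 4)%N (j %% 4)%N.
  rewrite !weight_diag_class //; last first.
    by rewrite pow2_ge4E // addnC modnMDl.
  set d := (j %/ 4)%N%:Z - _.
  have -> : ((j + 2 ^ m) %/ 4)%N%:Z - (i %/ 4)%N%:Z = d + 2 ^+ (m - 2).
    rewrite pow2_ge4E // addnC divnMDl // PoszD Posz_pow2 /d; lia.
  (* Otherwise [i] and [j], already congruent modulo 4, would be congruent modulo [2 ^ m]. *)
  have ndvd : ~~ (2 ^+ (m - 2) %| d)%Z.
    apply: contra ij => /dvdzP[e dE]; rewrite eq_sym -eqz_nat -!modz_nat eqz_mod_dvd.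
    apply/dvdzP; exists e; rewrite pow2_ge4E // PoszM mulrA Posz_pow2.
    by rewrite -dE /d; lia.
  rewrite diag_weight_add // /flip normrM normr_t mul1r.
  have [m2E|m_neq2] := eqVneq m 2; first by move: ndvd; rewrite m2E dvd1z.
  have -> : ((m - 2)%N%:Z + 3 = m%:Z + 1) by lia.
  by case: ifP; rewrite ?mulrN.
rewrite /weight /shape_entry !inord_mod4 pow2_ge4E // !(addnC j (_ * 4)%N) divnMDl //.
rewrite !modnMDl (negPf ij4) !addr0 /flip normrM normr_parity_sign mul1r.
move: (B_lt (inord (i %% 4)) (inord (j %% 4))); set b := B _ _ => b_lt.
have -> : (2 ^ (m - 2) + j %/ 4)%N%:Z - (i %/ 4)%N%:Z =
          (j %/ 4)%N%:Z - (i %/ 4)%N%:Z + (2 ^ (m - 2))%N%:Z by lia.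
have [->|m_neq2] := eqVneq m 2; first by rewrite b_lt parity_sign_add1 mulNr.
have -> : parity_sign ((j %/ 4)%N%:Z - (i %/ 4)%N%:Z + (2 ^ (m - 2))%N%:Z) =
          parity_sign ((j %/ 4)%N%:Z - (i %/ 4)%N%:Z).
  by rewrite /parity_sign rpredDr // dvdzE dvdn_exp //; lia.
(* Here the norm is below 4, hence below [m + 1], and [flip m] changes nothing. *)
by rewrite ifN //; lia.
Qed.

Lemma weight_period m i j : (2 <= m)%N -> i != j %[mod 2 ^ m] ->
  weight B t i (j + 2 ^ m + 2 ^ m) = weight B t i j.
Proof. by move=> m2 ij; rewrite !weight_addr ?modnDr ?flipK. Qed.

Lemma weight_addl m i j : (2 <= m)%N -> i != j %[mod 2 ^ m] ->
  weight B t (i + 2 ^ m) j = flip m (weight B t i j).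
Proof.
move=> m2 ij; rewrite -weight_addr // -(weight_shift i (j + 2 ^ m) m2).
by rewrite weight_period // modnDr.
Qed.

Lemma weight_translate m (e g : bool) i j : (2 <= m)%N -> i != j %[mod 2 ^ m] ->
  weight B t (i + e * 2 ^ m) (j + g * 2 ^ m) =
  if e == g then weight B t i j else flip m (weight B t i j).
Proof.
move=> m2 ij; case: e; case: g; rewrite ?mul1n ?mul0n ?addn0 //=.
- exact: weight_shift.
- exact: weight_addl.
- exact: weight_addr.
Qed.

(** Translating by [2 ^ m.+1] is translating twice by [2 ^ m], and [flip m] is an involution. *)
Lemma flipS_weight m i j : (2 <= m)%N -> i != j %[mod 2 ^ m] ->
  flip m.+1 (weight B t i j) = weight B t i j.
Proof.
move=> m2 ij; have m2' : (2 <= m.+1)%N by apply: leqW.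
rewrite -[in LHS](weight_addr m2'); first by rewrite expnS mul2n -addnn addnA weight_period.
apply: contra ij => /eqP ijE; apply/eqP.
have dvd_m : (2 ^ m %| 2 ^ m.+1)%N by rewrite dvdn_exp2l.
by rewrite -(modn_dvdm i dvd_m) ijE modn_dvdm.
Qed.

Lemma weight_diag i : weight B t i i = 0.
Proof. by rewrite weight_diag_class // subrr mulr0. Qed.

(** The congruent case left out of [weight_addr]: the block difference is [2 ^ (m - 2)], of weight
    [(m - 2) + 4]. *)
Lemma weight_diag_addr m i : (2 <= m)%N ->
  weight B t i (i + 2 ^ m) = t * (m%:Z + 2).
Proof.
move=> m2; have mE := pow2_ge4E m2.
rewrite weight_diag_class; last by rewrite mE addnC modnMDl.
rewrite mE addnC divnMDl // PoszD addrK Posz_pow2 diag_weight_pow; congr (_ * _); lia.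
Qed.

Lemma weight_diag_addl m i : (2 <= m)%N ->
  weight B t (i + 2 ^ m) i = - (t * (m%:Z + 2)).
Proof.
move=> m2; have mE := pow2_ge4E m2.
rewrite weight_diag_class; last by rewrite mE addnC modnMDl.
rewrite mE addnC divnMDl // PoszD opprD addrCA subrr addr0 Posz_pow2.
rewrite diag_weight_opp_pow -mulrN; congr (_ * _); lia.
Qed.

End Weight.

(** * The two matrices as instances of [weight] *)

Lemma M4_diag r : M4 r r = 0.
Proof. by rewrite mxE; case: r => -[|[|[|[|]]]]. Qed.

Lemma M4star_diag r : M4star r r = 0.
Proof. by rewrite mxE; case: r => -[|[|[|[|]]]]. Qed.

Lemma M4_lt r s : `|M4 r s| < 4.
Proof. by rewrite mxE; case: r s => -[|[|[|[|]]]] // ? [[|[|[|[|]]]]]. Qed.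

Lemma M4star_lt r s : `|M4star r s| < 4.
Proof. by rewrite mxE; case: r s => -[|[|[|[|]]]] // ? [[|[|[|[|]]]]]. Qed.

#[local] Hint Resolve M4_diag M4star_diag M4_lt M4star_lt : core.

Local Notation mu := (weight M4 1).
Local Notation mus := (weight M4star (-1)).

Lemma ME n (i j : 'I_(2 ^ n)) : M n i j = mu i j.
Proof. by rewrite mxE blockE. Qed.

Lemma MstarE n (i j : 'I_(2 ^ n)) : Mstar n i j = mus i j.
Proof. by rewrite mxE block_starE. Qed.

Lemma weight_small (B : 'M_4) t i j :
  (i < 4)%N -> (j < 4)%N -> (forall r, B r r = 0) ->
  weight B t i j = B (inord i) (inord j).
Proof.
move=> i4 j4 B_diag; rewrite /weight /shape_entry !divn_small // !modn_small //.
by rewrite subrr /diag_weight eqxx mulr0 mul0rn addr0 mul1r.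
Qed.

(** * The maps sigma in terms of the top binary digit *)

(** With [f] and [e] the top binary digits, the cases of the recursion merge: the digit [e] is
    negated, except at the other lift of the deleted point, which stays fixed. *)
Lemma sigma_nat_double m (f e : bool) k i : (2 <= m)%N ->
    (k < 2 ^ m)%N -> (i < 2 ^ m)%N -> (i == k -> e != f) ->
  sigma_nat m.+1 (k + f * 2 ^ m) (i + e * 2 ^ m) =
  (if i == k then i + e * 2 ^ m else sigma_nat m k i + ~~ e * 2 ^ m)%N.
Proof.
case: m => [|[|m]] // _.
set h := (2 ^ m.+2)%N => kh ih ik.
have -> K I : sigma_nat m.+3 K I = (
      if K < h then
        if I < h then sigma_nat m.+2 K I + h
        else if I == K + h then I
        else sigma_nat m.+2 K (I - h)
      else
        if I < h then
          if I == K - h then I else sigma_nat m.+2 (K - h) I + h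
        else sigma_nat m.+2 (K - h) (I - h))%N by [].
move: ik; case: f; case: e; rewrite ?mul1n ?mul0n ?addn0 ?kh ?ih /=
  ?[(_ + h < h)%N]ltnNge ?leq_addl /= ?addnK ?eqn_add2r.
- by case: eqP => // _ /(_ isT).
- by [].
- by [].
- by case: eqP => // _ /(_ isT).
Qed.

Lemma binary_split m i : (i < 2 ^ m.+1)%N ->
  exists i' (e : bool), (i' < 2 ^ m)%N /\ i = (i' + e * 2 ^ m)%N.
Proof.
rewrite expnS mul2n -addnn => iN; have [ih|ih] := ltnP i (2 ^ m).
  by exists i, false; rewrite addn0.
by exists (i - 2 ^ m)%N, true; rewrite ltn_subLR // mul1n subnK.
Qed.

Lemma eq_translate m (e f : bool) i k : (i < 2 ^ m)%N -> (k < 2 ^ m)%N ->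
  (i + e * 2 ^ m == k + f * 2 ^ m)%N = (i == k) && (e == f).
Proof. by move=> ih kh; case: e; case: f; rewrite /=; lia. Qed.

(** Serves twice: for bijectivity, and to keep images of distinct points incongruent modulo [2 ^ m]
    so that translation applies to them. *)
Lemma sigma_nat_inj m k i j : (2 <= m)%N ->
    (k < 2 ^ m)%N -> (i < 2 ^ m)%N -> (j < 2 ^ m)%N -> i != k -> j != k ->
  sigma_nat m k i = sigma_nat m k j -> i = j.
Proof.
move=> m2; elim: m m2 k i j => // m IHm.
rewrite leq_eqVlt => /predU1P[[<-] k i j|m2 k i j].
  by case: k i j => [|[|[|[|k]]]] [|[|[|[|i]]]] [|[|[|[|j]]]].
move=> /binary_split[k' [f [k'h ->]]] /binary_split[i' [e [i'h ->]]].
move=> /binary_split[j' [g [j'h ->]]]; rewrite !eq_translate // => ik jk.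
rewrite !sigma_nat_double //; try by move=> /eqP ?; lia.
case: eqVneq ik => [->|i'k] ik; case: eqVneq jk => [->|j'k] jk //.
- have /andP[s_lt /negPf s_k] := sigma_nat_range k'h j'h j'k.
  by move/eqP; rewrite eq_translate // eq_sym s_k.
- have /andP[s_lt /negPf s_k] := sigma_nat_range k'h i'h i'k.
  by move/eqP; rewrite eq_translate // s_k.
have /andP[si_lt _] := sigma_nat_range k'h i'h i'k.
have /andP[sj_lt _] := sigma_nat_range k'h j'h j'k.
move/eqP; rewrite eq_translate // => /andP[/eqP/IHm -> // /eqP/negb_inj ->] //.
Qed.

(** * Invariance of entries under the maps sigma *)

Lemma neq_mod p i j : (i < p)%N -> (j < p)%N -> i != j -> i != j %[mod p].
Proof. by move=> ip jp; rewrite !modn_small. Qed.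

Lemma weight_sigma_deleted m k i : (2 <= m)%N ->
    (k < 2 ^ m)%N -> (i < 2 ^ m)%N -> i != k ->
  mu i k = flip m (mus (sigma_nat m k i) k) /\
  mu k i = flip m (mus k (sigma_nat m k i)).
Proof.
move=> m2; elim: m m2 k i => // m IHm.
rewrite leq_eqVlt => /predU1P[[<-] k i k4 i4 ik|m2 k i].
  have /andP[s4 _] := sigma_nat_range k4 i4 ik.
  rewrite !weight_small //.
  rewrite !mxE !inordK // /flip.
  by move: k i ik {k4 i4 s4} (k4) (i4) => [|[|[|[|k]]]] [|[|[|[|i]]]].
move=> /binary_split[k' [f [k'h ->]]] /binary_split[i' [e [i'h ->]]].
rewrite eq_translate // => ik; rewrite sigma_nat_double //; last first.
  by move=> i'k; move: ik; rewrite i'k.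
case: eqVneq ik => [-> ef|i'k _].
  (* The index is the other lift of [k']: the two entries are opposite, of norm [m + 2], exactly the
     norm that [flip m.+1] negates. *)
  have flipE (z : int) : `|z| = m%:Z + 2 -> flip m.+1 z = - z.
    by move=> zE; rewrite /flip zE ifT //; case: eqP => //; lia.
  rewrite !flipE; case: e f ef => -[] // _;
    rewrite mul1n mul0n addn0 ?weight_diag_addr ?weight_diag_addl //; lia.
have /andP[s_lt s_k] := sigma_nat_range k'h i'h i'k.
have [IHl IHr] := IHm m2 _ _ k'h i'h i'k.
rewrite !weight_translate ?neq_mod ?M4_lt ?M4star_lt // 1?eq_sym //.
(* Since [e] is negated, exactly one side carries a [flip m] from translation, matching the
   induction hypothesis; the outer [flip m.+1] acts trivially. *)
case: e f => -[]; rewrite /= -?IHl -?IHr ?flipS_weight ?neq_mod // 1?eq_sym //;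
  by rewrite IHl IHr !flipK.
Qed.

Lemma weight_sigma m k i j : (2 <= m)%N ->
    (k < 2 ^ m)%N -> (i < 2 ^ m)%N -> (j < 2 ^ m)%N -> i != k -> j != k ->
  mu i j = mus (sigma_nat m k i) (sigma_nat m k j).
Proof.
move=> m2; elim: m m2 k i j => // m IHm.
rewrite leq_eqVlt => /predU1P[[<-] k i j k4 i4 j4 ik jk|m2 k i j].
  have /andP[si4 _] := sigma_nat_range k4 i4 ik.
  have /andP[sj4 _] := sigma_nat_range k4 j4 jk.
  rewrite !weight_small // !mxE !inordK //.
  by move: k i j ik jk {si4 sj4} k4 i4 j4
    => [|[|[|[|k]]]] [|[|[|[|i]]]] [|[|[|[|j]]]].
move=> /binary_split[k' [f [k'h ->]]] /binary_split[i' [e [i'h ->]]].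
move=> /binary_split[j' [g [j'h ->]]]; rewrite !eq_translate // => ik jk.
rewrite !sigma_nat_double //; first last.
- by move=> i'k; move: ik; rewrite i'k.
- by move=> j'k; move: jk; rewrite j'k.
case: (eqVneq i' k') ik => [-> ef|i'k _]; case: (eqVneq j' k') jk => [-> gf|j'k _].
(* Both indices are the lift of [k'] that is not deleted, hence equal. *)
- have -> : e = g by case: e g f ef gf => -[] [].
  by rewrite !weight_diag.
(* Only the second index changes half; the resulting [flip m] cancels the one from
   [weight_sigma_deleted]. *)
- have /andP[s_lt s_k] := sigma_nat_range k'h j'h j'k.
  have [_ kj] := weight_sigma_deleted m2 k'h j'h j'k.
  rewrite !weight_translate ?neq_mod // 1?eq_sym // kj flipK.
  by case: e g {ef} => -[].
- have /andP[s_lt s_k] := sigma_nat_range k'h i'h i'k.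
  have [ik _] := weight_sigma_deleted m2 k'h i'h i'k.
  rewrite !weight_translate ?neq_mod // ik flipK.
  by case: e g {gf} => -[].
have /andP[si_lt _] := sigma_nat_range k'h i'h i'k.
have /andP[sj_lt _] := sigma_nat_range k'h j'h j'k.
(* For the two lifts of one point, switching halves reverses the block difference, and this sign
   cancels the one between [t = 1] and [t = -1]. *)
have [->|ij] := eqVneq i' j'.
  by case: e g => -[];
    rewrite ?mul1n ?mul0n ?addn0 ?weight_diag ?weight_diag_addl
      ?weight_diag_addr // mulN1r mul1r ?opprK.
have s_ij : sigma_nat m k' i' != sigma_nat m k' j'.
  by apply: contra_neq ij => /sigma_nat_inj->.
rewrite !weight_translate ?neq_mod // (IHm m2 k') //.
by case: e g => -[].
Qed.

Lemma sigma_inj n (k : 'I_(2 ^ n)) : (2 <= n)%N -> injective (sigma k).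
Proof.
move=> n2 [i ik] [j jk] /(congr1 (fun x => val (val x))) /= eq_s.
by apply/val_inj/val_inj; apply: (sigma_nat_inj n2 _ _ _ _ _ eq_s).
Qed.

Theorem theorem1 (n : nat) (hn : (2 <= n)%N) :
  (forall (k : 'I_(2 ^ n)) (i j : points_but k),
     M n (sval i) (sval j) = Mstar n (sval (sigma k i)) (sval (sigma k j))) /\
  hypomorphic_under (M n) (Mstar n) (del := fun k => k) (@sigma n).
Proof.
have M_sigma (k : 'I_(2 ^ n)) (i j : points_but k) :
    M n (sval i) (sval j) = Mstar n (sval (sigma k i)) (sval (sigma k j)).
  case: i j => [i ik] [j jk].
  by rewrite ME MstarE /= (weight_sigma hn (ltn_ord k) (ltn_ord i) (ltn_ord j)).
split=> //; split=> [|k]; first by exists id.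
by split=> //; exact: injF_bij (@sigma_inj n k hn).
Qed.
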